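(* Let $\epsilon,\delta>0$, $\Delta_\infty>0$, let $T$ be the number of iterations of the row-private LP algorithm (described in the context) and $\epsilon'=\epsilon/(4\sqrt{dT\log(1/\delta)})$. The row-private LP algorithm, run with a dual oracle that is $\epsilon'$-differentially private with respect to changes of $A$ of at most $\Delta_\infty$ in entrywise $\ell_\infty$ norm, is $(\epsilon,\delta)$-low sensitivity row private with sensitivity $\Delta_\infty$.
   Context: Inputs: $A\in[-1,1]^{m\times d}$, $b\in\mathbb{R}^m$. A randomized algorithm $\mathcal{M}(b,A)$ with output in $\mathbb{R}^d$ is $(\epsilon,\delta)$-low sensitivity row private with sensitivity $\Delta_\infty$ if for all $A,A'$ with $\max_{i,j}|A_{ij}-A'_{ij}|\le\Delta_\infty$ and all $S\subseteq\mathbb{R}^d$, $\Pr[\mathcal{M}(b,A)\in S]\le e^\epsilon\Pr[\mathcal{M}(b,A')\in S]+\delta$. An $(\alpha,\gamma)$-dual oracle, given $A,b,x$, outputs $i\in[m]$ with $A_ix-b_i\ge\max_j(A_jx-b_j)-\alpha$ with probability at least $1-\gamma$. $\mathrm{Lap}(\lambda)$ denotes a Laplace random variable with density $\frac1{2\lambda}e^{-|\nu|/\lambda}$. Row-private LP algorithm (accuracy parameter $\alpha$): $T=144\log d/\alpha^2$, $\eta=\sqrt{\log d/T}$, $\tilde x^1$ uniform on $[d]$. For $t=1,\dots,T$: $p^t=\mathrm{Oracle}(A,b,\tilde x^t)$; for each $i\in[d]$, $\hat\ell^t_i=\frac12\big(A_{p^ti}+\nu^t_i\big)$ with independent $\nu^t_i\sim\mathrm{Lap}(\Delta_\infty/\epsilon')$;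 $x^{t+1}_i=e^{-\eta\hat\ell^t_i}\tilde x^t_i$; $\tilde x^{t+1}=x^{t+1}/\sum_ix^{t+1}_i$. Output $\bar x=\frac1T\sum_t\tilde x^t$.
   Formalization: The formal theorem adds the assumption ε ≤ 8 log(1/δ) (so δ < 1): for δ ≥ 1 the quantity ε' is undefined, and for δ < 1 with ε much larger than log(1/δ) the claim is false; T is rounded up to an integer. *)

(* Defs.v *)
(* All logarithms are natural. *)
From HB Require Import structures.
From mathcomp Require Import all_boot all_order all_algebra.
From mathcomp Require Import all_classical all_reals all_analysis.

Set Implicit Arguments.
Unset Strict Implicit.
Unset Printing Implicit Defensive.

Import Order.TTheory GRing.Theory Num.Theory.
Import numFieldNormedType.Exports.

Local Open Scope classical_set_scope.
Local Open Scope ring_scope.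

(* Vectors of R^d are tuples, which carry the product (Borel) sigma-algebra. *)

Definition in_box (R : realType) (m d : nat) (A : 'M[R]_(m, d)) : Prop :=
  forall i j, -1 <= A i j <= 1.

Definition entrywise_close (R : realType) (m d : nat) (Delta : R)
    (A A' : 'M[R]_(m, d)) : Prop :=
  forall i j, `|A i j - A' i j| <= Delta.

Definition in_simplex (R : realType) (d : nat) (x : d.-tuple R) : Prop :=
  (forall i, 0 <= tnth x i) /\ \sum_(i < d) tnth x i = 1.

(* A randomized algorithm is represented by its output law: [M b A S] is the
   probability that M(b, A) lies in S.  Events are the Borel sets. *)
Definition low_sensitivity_row_private (R : realType) (m d : nat)
    (M : m.-tuple R -> 'M[R]_(m, d) -> set (d.-tuple R) -> \bar R)
    (eps delta Delta : R) : Prop :=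
  forall (b : m.-tuple R) (A A' : 'M[R]_(m, d)),
    in_box A -> in_box A' -> entrywise_close Delta A A' ->
    forall S : set (d.-tuple R), measurable S ->
      (M b A S <= (expR eps)%:E * M b A' S + delta%:E)%E.

(* A randomized map to the finite set of rows: [pick A b x i] is the probability
   of answering i.  Measurability in x is what makes the law of an algorithm
   calling it at random points well defined. *)
Record oracle (R : realType) (m d : nat) := Oracle {
  pick :> 'M[R]_(m, d) -> m.-tuple R -> d.-tuple R -> 'I_m -> R;
  pick_ge0 : forall A b x i, 0 <= pick A b x i;
  pick_sum1 : forall A b x, \sum_(i < m) pick A b x i = 1;
  measurable_pick : forall A b i,
    measurable_fun [set: d.-tuple R] (fun x => pick A b x i)
}.

Definition violation (R : realType) (m d : nat) (A : 'M[R]_(m, d))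
    (b : m.-tuple R) (x : d.-tuple R) (i : 'I_m) : R :=
  \sum_(j < d) A i j * tnth x j - tnth b i.

(* The guarantees of an oracle are only required at points of the simplex,
   where all its queries lie. *)
Definition dual_oracle (R : realType) (m d : nat) (alpha gamma : R)
    (Orc : oracle R m d) : Prop :=
  forall A b x, in_box A -> in_simplex x ->
    1 - gamma <=
      \sum_(i < m | [forall j, violation A b x j - alpha <= violation A b x i])
        Orc A b x i.

Definition oracle_private (R : realType) (m d : nat) (Orc : oracle R m d)
    (eps Delta : R) : Prop :=
  forall A A' b x, in_box A -> in_box A' -> entrywise_close Delta A A' ->
    in_simplex x ->
    forall S : {set 'I_m},
      \sum_(i in S) Orc A b x i <= expR eps * \sum_(i in S) Orc A' b x i.

Definition laplace_pdf (R : realType) (lam v : R) : R :=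
  (2 * lam)^-1 * expR (- `|v| / lam).

(* Expectation of f(v_1, ..., v_n) for v_1, ..., v_n i.i.d. Lap(lam), as an
   iterated integral. *)
Fixpoint laplace_expect (R : realType) (lam : R) (n : nat) :
    (n.-tuple R -> \bar R) -> \bar R :=
  match n with
  | 0 => fun f => f [tuple]
  | k.+1 => fun f =>
      (\int[lebesgue_measure]_v
         ((laplace_pdf lam v)%:E *
          laplace_expect lam (fun w : k.-tuple R => f [tuple of v :: w])))%E
  end.

(* Rounded up to an integer. *)
Definition num_iter (R : realType) (d : nat) (alpha : R) : nat :=
  `|Num.ceil (144 * ln (d%:R : R) / alpha ^+ 2)|%N.

Definition learning_rate (R : realType) (d : nat) (alpha : R) : R :=
  Num.sqrt (ln (d%:R : R) / (num_iter d alpha)%:R).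

Definition noisy_loss (R : realType) (m d : nat) (A : 'M[R]_(m, d)) (p : 'I_m)
    (nu : d.-tuple R) (i : 'I_d) : R :=
  (A p i + tnth nu i) / 2.

Definition mw_update (R : realType) (d : nat) (eta : R) (x : d.-tuple R)
    (l : 'I_d -> R) : d.-tuple R :=
  let w i := expR (- eta * l i) * tnth x i in
  [tuple w i / \sum_(j < d) w j | i < d].

Section RowPrivateLP.
Variables (R : realType) (m d : nat) (Orc : oracle R m d) (alpha lam : R).
Variables (b : m.-tuple R) (A : 'M[R]_(m, d)).

(* Probability that the output lies in S when n rounds remain, the current
   iterate is x and the previous iterates add up to s: a round draws p from the
   oracle at x, then d fresh independent Lap(lam) variables. *)
Fixpoint lp_rounds (n : nat) (s x : d.-tuple R) (S : set (d.-tuple R)) :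
    \bar R :=
  match n with
  | 0 => \d_([tuple tnth s i / (num_iter d alpha)%:R | i < d]) S
  | k.+1 =>
      (\sum_(p < m) (Orc A b x p)%:E *
         laplace_expect lam (fun nu : d.-tuple R =>
           lp_rounds k
             [tuple (tnth s i + tnth x i)%R | i < d]
             (mw_update (learning_rate d alpha) x (noisy_loss A p nu)) S))%E
  end.

End RowPrivateLP.

Definition row_private_lp (R : realType) (m d : nat) (Orc : oracle R m d)
    (alpha lam : R) (b : m.-tuple R) (A : 'M[R]_(m, d)) :
    set (d.-tuple R) -> \bar R :=
  lp_rounds Orc alpha lam b A (num_iter d alpha)
    [tuple 0 | i < d] [tuple d%:R^-1 | i < d].

(* Main.v *)
(* Let V_n and V'_n be the probabilities that the output lands in S, from the
   same state with n rounds to go, under A and A'.  With kap > 0 to be chosen,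
   induction on the number of private steps shows
     V_n <= e^t V'_n + K_n e^(- kap t)   for every real t,
   the dual form of a bound on the moments of the likelihood ratio.  A step with
   densities p and q preserves this shape: apply the induction hypothesis with t
   replaced by t - ln (p / q) at each outcome and integrate.  The new constant is
   K times the integral of p (p / q)^kap, which is estimated through the chord of
   the convex function r^(kap + 1) over the range of p / q; the result is a ratio of
   hyperbolic cosines, at most exp (kap (kap + 1) eps'^2 / 2).  As
   T (d + 1) <= 2 d T, the choice t = eps, kap = 4 ln (1 / delta) / eps concludes. *)
Require Import Defs.
From HB Require Import structures.
From mathcomp Require Import all_boot all_order all_algebra.
From mathcomp Require Import all_classical all_reals all_analysis.
From mathcomp Require Import measurable_realfun ring lra.

Import Order.TTheory GRing.Theory Num.Theory.
Import numFieldNormedType.Exports HBNNSimple.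
Local Open Scope classical_set_scope.
Local Open Scope ring_scope.

Set Implicit Arguments.
Unset Strict Implicit.
Unset Printing Implicit Defensive.

(** * Hyperbolic estimates and the chord bound *)

(** The right side minus the left vanishes at 0 and has derivative [y * (expR y - expR (- y))],
    nonnegative for [y >= 0]. *)
Lemma sinh_le_mul_cosh (R : realType) (x : R) : 0 <= x ->
  expR x - expR (- x) <= x * (expR x + expR (- x)).
Proof.
move=> x0; rewrite -subr_ge0.
pose g (y : R) := y * (expR y + expR (- y)) - (expR y - expR (- y)).
have dg (y : R) : is_derive y 1 g (y * (expR y - expR (- y))).
  by apply: is_derive_eq; rewrite /GRing.scale/=; ring.
have -> : 0 = g 0 by rewrite /g oppr0 expR0; ring.
apply: (@ger0_derive1_le_cc _ g 0 x); rewrite ?in_itv/= ?lexx//.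
- move=> y; rewrite in_itv/= => /andP[y0 _].
  rewrite derive1E (@derive_val _ _ _ _ _ _ _ (dg y)) mulr_ge0 ?(ltW y0)//.
  rewrite subr_ge0 ler_expR; lra.
- apply: continuous_subspaceT => y.
  by apply/differentiable_continuous/derivable1_diffP; have [] := dg y.
- by rewrite x0.
Qed.

(** The function cosh z * exp (- z^2 / 2) is nonincreasing on z >= 0: its derivative has the sign of
    sinh z - z cosh z. *)
Lemma cosh_ratio_le (R : realType) (x y : R) : 0 <= y -> y <= x ->
  expR x + expR (- x) <=
  (expR y + expR (- y)) * expR ((x ^+ 2 - y ^+ 2) / 2).
Proof.
move=> y0 yx.
pose f (z : R) := (expR z + expR (- z)) * expR (- (z ^+ 2 / 2)).
have df (z : R) : is_derive z 1 f (expR (- (z ^+ 2 / 2)) *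
    (expR z - expR (- z) - z * (expR z + expR (- z)))).
  by apply: is_derive_eq; rewrite /GRing.scale/=; field.
suff : f x <= f y.
  rewrite /f -ler_pdivlMr ?expR_gt0// -mulrA -expRN -expRD opprK.
  by congr (_ <= _ * expR _); field.
apply: (@ler0_derive1_le_cc _ f 0 x);
  rewrite ?in_itv/= ?lexx ?y0 ?yx// ?(le_trans y0)//.
- move=> z; rewrite in_itv/= => /andP[z0 _].
  rewrite derive1E (@derive_val _ _ _ _ _ _ _ (df z)) mulr_ge0_le0//.
  rewrite subr_le0; exact/sinh_le_mul_cosh/ltW.
- apply: continuous_subspaceT => z.
  by apply/differentiable_continuous/derivable1_diffP; have [] := df z.
Qed.

(** With r = e^u, [al * r + be] is a chord lying above the convex r^(kap + 1). Only its value
    [al + be] at r = 1 has to be small, because [al * p + be * q] has total mass [al + be] when [p]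
    and [q] have mass 1. *)
Lemma expR_chord (R : realType) (eps kap : R) : 0 < eps -> 0 <= kap ->
  exists al be : R,
    al + be <= expR (kap * (kap + 1) * eps ^+ 2 / 2) /\
    forall u, `|u| <= eps -> expR ((kap + 1) * u) <= al * expR u + be.
Proof.
move=> e0 k0; set a := kap + 1.
pose E := expR eps; pose F := expR (- eps).
have FE : F < E by rewrite ltr_expR; lra.
have EF0 : E - F != 0 by rewrite subr_eq0 gt_eqF.
(* The chord of r^a over [F, E]. *)
pose al := (expR (a * eps) - expR (- (a * eps))) / (E - F).
exists al, (expR (- (a * eps)) - al * F); split.
  (* The value at 1 is cosh ((a - 1/2) eps) / cosh (eps / 2). In terms of h = e^(eps / 2) this is an
     identity of rational functions. *)
  have -> : al + (expR (- (a * eps)) - al * F) =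
      (expR (a * eps - eps / 2) + expR (- (a * eps - eps / 2))) /
      (expR (eps / 2) + expR (- (eps / 2))).
    pose h := expR (eps / 2).
    have hp : 0 < h by exact: expR_gt0.
    have EE : E = h ^+ 2 by rewrite /E /h expr2 -expRD; congr expR; field.
    have FF : F = h ^- 2 by rewrite /F expRN -/E EE.
    have h1 : 1 < h by rewrite /h expR_gt1; lra.
    rewrite /al EE FF opprB !expRD !expRN -/h.
    have xp : 0 < expR (a * eps) by exact: expR_gt0.
    move: (expR _) xp => X xp.
    have h4 : h ^+ 4 > 1 by apply: exprn_egt1.
    field.
    rewrite ?gt_eqF// ?andbT/=; try lra.
    by rewrite addr_gt0// mulr_gt0.
  rewrite ler_pdivrMr ?addr_gt0 ?expR_gt0// [leRHS]mulrC.
  have -> : kap * a * eps ^+ 2 / 2 =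
            ((a * eps - eps / 2) ^+ 2 - (eps / 2) ^+ 2) / 2 by rewrite /a; field.
  apply: cosh_ratio_le; first lra.
  have : 0 <= kap * eps by rewrite mulr_ge0// ltW.
  rewrite /a mulrDl mul1r; lra.
move=> u ue; move: (ue); rewrite ler_norml => /andP[u1 u2].
have uF : F <= expR u by rewrite ler_expR.
have uE : expR u <= E by rewrite ler_expR.
(* Barycentric coordinate of e^u in [F, E], at which convexity is applied. *)
pose s := (expR u - F) / (E - F).
have EFp : 0 < E - F by rewrite subr_gt0.
have s0 : 0 <= s by rewrite divr_ge0 ?subr_ge0// ltW.
have s1 : s <= 1 by rewrite ler_pdivrMr// mul1r lerD2r.
have a1 : 1 <= a by rewrite /a lerDr.
have := convex_powR a1 (Itv01 s0 s1) (x := E) (y := F).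
rewrite !inE/= !in_itv/= !andbT !expR_ge0 => /(_ isT isT).
have pw t : expR t `^ a = expR (a * t) by rewrite /powR gt_eqF ?expR_gt0// expRK.
have cE : s * E + unstable.onem s * F = expR u.
  by rewrite /unstable.onem /s; field.
rewrite convRE [X in X `^ _ <= _]convRE/= cE /E /F !pw mulrN => /le_trans; apply.
rewrite le_eqVlt; apply/orP; left; apply/eqP.
by rewrite /unstable.onem /al /s /E /F; field.
Qed.

(** * Lower integrals and translations *)

(* For a nonnegative function that need not be measurable, the library's integral
   is the lower integral (a supremum over simple functions below it).  Working
   with it spares any measurability proof for the law of the algorithm. *)
Lemma ge0_le_lower_integral d (T : measurableType d) (R : realType)
    (mu : {measure set T -> \bar R}) (g f : T -> \bar R) :
  measurable_fun setT g -> (forall x, 0 <= g x)%E -> (forall x, g x <= f x)%E ->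
  (\int[mu]_x g x <= \int[mu]_x f x)%E.
Proof.
move=> mg g0 gf.
have f0 x : (0 <= f x)%E by exact: le_trans (gf x).
pose gn := nnsfun_approx measurableT mg.
rewrite (@nd_ge0_integral_lim _ _ _ _ _ gn)//; last 2 first.
- by move=> x m n mn; exact/lefP/nd_nnsfun_approx.
- by move=> x; apply: cvg_nnsfun_approx => // y _.
apply: lime_le.
  by apply: is_cvg_sintegral => x m n mn; exact/lefP/nd_nnsfun_approx.
apply: nearW => n; rewrite (ge0_integralTE _ f0).
apply: ereal_sup_ubound; exists (gn n) => //= x.
apply: le_trans (gf x).
by rewrite nnsfun_approxE; exact: le_approx.
Qed.

(** Lower integrals are not additive in general, but here [g] is measurable: a simple [h] below [f]
    yields the measurable function max (h - g, 0) / c, which lies below [f'] and satisfies h <= c k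
    + g. *)
Lemma lower_integral_le_comb d (T : measurableType d) (R : realType)
    (mu : {measure set T -> \bar R}) (c : R) (f f' : T -> \bar R) (g : T -> R) :
  0 < c -> (forall x, 0 <= f x)%E -> (forall x, 0 <= f' x)%E ->
  (forall x, 0 <= g x) -> measurable_fun setT g ->
  (forall x, f x <= c%:E * f' x + (g x)%:E)%E ->
  (\int[mu]_x f x <= c%:E * \int[mu]_x f' x + \int[mu]_x (g x)%:E)%E.
Proof.
move=> c0 f0 f'0 g0 mg fle.
rewrite (ge0_integralTE _ f0); apply: ge_ereal_sup => _ [h /= hf <-].
pose k x := Num.max (h x - g x) 0 / c.
have mh : measurable_fun setT h by exact: measurable_funPT.
have mk : measurable_fun setT k.
  apply: measurable_funM => //; apply: measurable_maxr => //.
  exact: measurable_funB.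
have k0 x : 0 <= k x by rewrite divr_ge0 ?le_max ?lexx ?orbT// ltW.
have kf' x : ((k x)%:E <= f' x)%E.
  have := le_trans (hf x) (fle x); have := f'0 x.
  case: (f' x) => [r| |]//= r0; last by rewrite leey.
  rewrite -EFinM -EFinD !lee_fin /k => hr.
  rewrite ler_pdivrMr// ge_max mulrC; apply/andP; split; first lra.
  by rewrite mulr_ge0// ltW.
have le_f' : (\int[mu]_x (k x)%:E <= \int[mu]_x f' x)%E.
  by apply: ge0_le_lower_integral => //; exact/measurable_EFinP.
have -> : sintegral mu h = (\int[mu]_x (h x)%:E)%E.
  by rewrite integral_nnsfun// patch_setT.
apply: (@le_trans _ _ (\int[mu]_x (c%:E * (k x)%:E + (g x)%:E))%E).
  apply: ge0_le_integral => //.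
  - by move=> x _; rewrite lee_fin.
  - exact/measurable_EFinP.
  - apply: emeasurable_funD; last exact/measurable_EFinP.
    by apply/measurable_EFinP/measurable_funM.
  - move=> x _; rewrite -EFinM -EFinD lee_fin /k mulrC divfK ?gt_eqF//.
    by rewrite -lerBlDr le_max lexx.
rewrite ge0_integralD//=; last 4 first.
- by move=> x _; rewrite -EFinM lee_fin mulr_ge0// ltW.
- by apply/measurable_EFinP/measurable_funM.
- by move=> x _; rewrite lee_fin.
- exact/measurable_EFinP.
rewrite leeD2r// ge0_integralZl//=; first last.
- by rewrite lee_fin ltW.
- by move=> x _; rewrite lee_fin.
- exact/measurable_EFinP.
by rewrite lee_pmul2l// ?lte_fin// fin_numE.
Qed.

Lemma lebesgue_measure_shift (R : realType) (s : R) (A : set R) :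
  measurable A ->
  pushforward lebesgue_measure ((fun x => x + s) : _ -> measurableTypeR R) A =
  lebesgue_measure A.
Proof.
move=> mA; apply: esym; apply: (@lebesgue_measure_unique R) => //.
  exact: measurable_funD.
move=> ? X [[a b] _ <-].
rewrite /pushforward.
have E : (fun x : R => x + s) @^-1` `]a, b]%classic = `]a - s, b - s]%classic.
  by apply/predeqP => x /=; rewrite !in_itv/= ltrBlDr lerBrDr.
transitivity (lebesgue_measure (`]a - s, b - s]%classic : set R)); first last.
  by rewrite -E.
rewrite !lebesgue_measure_itv/= !lte_fin ltrD2r.
by case: ifP => // _; rewrite -!EFinD; congr EFin; ring.
Qed.

Lemma ge0_integral_shift (R : realType) (s : R) (f : R -> \bar R) :
  measurable_fun setT f -> (forall x, 0 <= f x)%E ->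
  (\int[lebesgue_measure]_x f (x + s)%R = \int[lebesgue_measure]_x f x)%E.
Proof.
move=> mf f0.
transitivity (\int[lebesgue_measure]_(x in
  ((fun x => x + s)%R : _ -> measurableTypeR R) @^-1` setT) f (x + s)%R)%E.
  by rewrite preimage_setT.
rewrite -ge0_integral_pushforward//=; last exact: measurable_funD.
apply: eq_measure_integral => //=; first exact: measurable_funD.
by move=> ? A mA _; exact: lebesgue_measure_shift.
Qed.

(** A simple function below the translate of [f] becomes, once translated back, a measurable
    function below [f] with the same integral. *)
Lemma lower_integral_shift_le (R : realType) (s : R) (f : R -> \bar R) :
  (forall x, 0 <= f x)%E ->
  (\int[lebesgue_measure]_x f (x + s)%R <= \int[lebesgue_measure]_x f x)%E.
Proof.
move=> f0; rewrite ge0_integralTE//; apply: ge_ereal_sup => _ [h /= hf <-].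
have -> : sintegral lebesgue_measure h = (\int[lebesgue_measure]_x (h x)%:E)%E.
  by rewrite integral_nnsfun// patch_setT.
have mh : measurable_fun setT (EFin \o h).
  by apply/measurable_EFinP; exact: measurable_funPT.
rewrite -(ge0_integral_shift (- s) mh)/=; last first.
  by move=> x; rewrite lee_fin.
apply: ge0_le_lower_integral.
- by apply: measurableT_comp mh _; exact: measurable_funD.
- by move=> x; rewrite lee_fin.
- by move=> x; have := hf (x - s); rewrite subrK.
Qed.

(** * The Laplace density *)

Section laplace.
Variables (R : realType) (lam : R).
Hypothesis lam_gt0 : 0 < lam.

Lemma laplace_pdf_gt0 v : 0 < laplace_pdf lam v.
Proof. by rewrite mulr_gt0 ?expR_gt0// invr_gt0 mulr_gt0. Qed.

Lemma continuous_laplace_pdf : continuous (laplace_pdf lam).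
Proof.
move=> v; apply: (@continuousM _ R^o (fun=> (2 * lam)^-1)
  (fun v => expR (- `|v| / lam))); first exact: cst_continuous.
apply: continuous_comp; last exact: continuous_expR.
apply: (@continuousM _ R^o (fun v => - `|v|) (fun=> lam^-1)).
  by apply: (@continuousN _ R^o); exact: norm_continuous.
exact: cst_continuous.
Qed.

Lemma measurable_laplace_pdf : measurable_fun setT (laplace_pdf lam).
Proof. by apply: continuous_measurable_fun; exact: continuous_laplace_pdf. Qed.

(** By symmetry the integral is twice that over the half-line, where twice the density is the
    exponential density of rate [lam^-1]. *)
Lemma integral_laplace_pdf :
  (\int[lebesgue_measure]_v (laplace_pdf lam v)%:E = 1)%E.
Proof.
rewrite ge0_symfun_integralT; last 3 first.
- by move=> v; exact/ltW/laplace_pdf_gt0.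
- exact: continuous_laplace_pdf.
- by move=> v; rewrite /laplace_pdf/= normrN.
rewrite -ge0_integralZl_EFin//; last 3 first.
- by rewrite -set_itvcy; exact: measurable_itv.
- by move=> v _; rewrite lee_fin ltW// laplace_pdf_gt0.
- by apply/measurable_EFinP; apply: measurable_funTS; exact: measurable_laplace_pdf.
have rate_gt0 : 0 < lam^-1 by rewrite invr_gt0.
rewrite -(integral_exponential_pdf rate_gt0) [LHS]integral_mkcond.
apply: eq_integral => v _; rewrite patchE; case: ifPn => [|/negP].
  rewrite inE/= => v0; rewrite exponential_pdfE// /laplace_pdf ger0_norm// -EFinM.
  have -> : - lam^-1 * v = - v / lam by rewrite !mulNr mulrC.
  by congr EFin; field; rewrite gt_eqF.
rewrite inE/= => /negP; rewrite -ltNge => v0.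
by rewrite lt0_exponential_pdf.
Qed.
End laplace.

(** * Propagation of the bound through private steps *)

(* The premise on x and y is used at t - ln (p / q). *)
Lemma mechanism_step (R : realType) (kap eps al be K p q t : R) (x y : \bar R) :
  0 <= K -> 0 < p -> p <= expR eps * q -> q <= expR eps * p ->
  (forall u, `|u| <= eps -> expR ((kap + 1) * u) <= al * expR u + be) ->
  (0 <= y)%E ->
  (forall t, x <= (expR t)%:E * y + (K * expR (- (kap * t)))%:E)%E ->
  0 <= al * p + be * q /\
  (p%:E * x <= (expR t)%:E * (q%:E * y)
     + (K * expR (- (kap * t)) * (al * p + be * q))%:E)%E.
Proof.
move=> K0 p0 pq qp chord y0 xy.
have q0 : 0 < q by rewrite -(pmulr_rgt0 _ (expR_gt0 eps)) (lt_le_trans p0).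
pose u := ln (p / q).
have pE : p = expR u * q by rewrite lnK ?divfK ?gt_eqF// posrE divr_gt0.
have ueps : `|u| <= eps.
  rewrite ler_norml; apply/andP; split; rewrite -ler_expR /u lnK ?posrE ?divr_gt0//.
    by rewrite ler_pdivlMr// expRN ler_pdivrMl ?expR_gt0.
  by rewrite ler_pdivrMr.
(* The left side is p (p / q)^kap; the bound is the chord inequality at [u] multiplied by [q]. *)
have pow : q * expR ((kap + 1) * u) <= al * p + be * q.
  rewrite [leRHS](_ : _ = q * (al * expR u + be)); last by rewrite pE; ring.
  by rewrite ler_pM2l// chord.
split; first by rewrite (le_trans _ pow)// mulr_ge0 ?expR_ge0// ltW.
have : (p%:E * x <= p%:E * ((expR (t - u))%:E * y
    + (K * expR (- (kap * (t - u))))%:E))%E.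
  by rewrite lee_pmul2l// fin_numE.
move=> /le_trans; apply.
rewrite ge0_muleDr; last 2 first.
- by rewrite mule_ge0// lee_fin expR_ge0.
- by rewrite lee_fin mulr_ge0 ?expR_ge0.
rewrite leeD//.
  rewrite !muleA -!EFinM pE expRD expRN.
  suff -> : expR u * q * (expR t / expR u) = expR t * q by [].
  by field; rewrite gt_eqF ?expR_gt0.
rewrite -EFinM lee_fin.
rewrite [leLHS](_ : _ = K * expR (- (kap * t)) * (q * expR ((kap + 1) * u))).
  by rewrite ler_wpM2l// mulr_ge0 ?expR_ge0.
rewrite pE mulrBr opprB addrC expRD mulrDl mul1r expRD; ring.
Qed.

Section composition.
Variables (R : realType) (kap eps : R).
Hypotheses (kap_ge0 : 0 <= kap) (eps_gt0 : 0 < eps).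

Let M := expR (kap * (kap + 1) * eps ^+ 2 / 2).

Lemma finite_step (m : nat) (p q : 'I_m -> R) (x y : 'I_m -> \bar R) (K t : R) :
  0 <= K -> (forall i, 0 <= p i) -> (forall i, 0 <= q i) ->
  \sum_i p i = 1 -> \sum_i q i = 1 ->
  (forall i, p i <= expR eps * q i) -> (forall i, q i <= expR eps * p i) ->
  (forall i, 0 <= x i)%E -> (forall i, 0 <= y i)%E ->
  (forall i t, x i <= (expR t)%:E * y i + (K * expR (- (kap * t)))%:E)%E ->
  (\sum_i (p i)%:E * x i <=
     (expR t)%:E * (\sum_i (q i)%:E * y i) + (K * M * expR (- (kap * t)))%:E)%E.
Proof.
move=> K0 p0 q0 p1 q1 pq qp x0 y0 xy.
have [al [be [albe chord]]] := expR_chord eps_gt0 kap_ge0.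
apply: (@le_trans _ _ (\sum_i ((expR t)%:E * ((q i)%:E * y i)
   + (K * expR (- (kap * t)) * (al * p i + be * q i))%:E))%E).
  (* Privacy in the other direction makes [q i] vanish with [p i], so the likelihood ratio is only
     formed at positive values. *)
  apply: lee_sum => i _; have [pi0|pi0] := eqVneq (p i) 0.
    have qi0 : q i = 0.
      by apply/eqP; rewrite eq_le q0 andbT (le_trans (qp i))// pi0 mulr0.
    by rewrite pi0 qi0 !mul0e !mulr0 mule0 addr0 mulr0 adde0.
  have pp : 0 < p i by rewrite lt_neqAle eq_sym pi0 p0.
  by have [_] := mechanism_step t K0 pp (pq i) (qp i) chord (y0 i) (xy i).
rewrite big_split/= -ge0_sume_distrr; last first.
  by move=> i _; rewrite mule_ge0// lee_fin.
rewrite leeD2l// sumEFin lee_fin -mulr_sumr big_split/= -!mulr_sumr p1 q1 !mulr1.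
by rewrite [leRHS]mulrAC ler_wpM2l// mulr_ge0 ?expR_ge0.
Qed.

Section laplace_step.
Variable Delta : R.
Hypothesis Delta_gt0 : 0 < Delta.
Let lam := Delta / eps.

Let lam_gt0 : 0 < lam. Proof. by rewrite divr_gt0. Qed.

Lemma laplace_pdf_shift_le (v s : R) : `|s| <= Delta ->
  laplace_pdf lam v <= expR eps * laplace_pdf lam (v + s).
Proof.
move=> sD; rewrite /laplace_pdf [leRHS]mulrCA ler_wpM2l//.
  by rewrite invr_ge0 mulr_ge0// ltW.
rewrite -expRD ler_expR -(@ler_pM2r _ lam)// mulrDl !divfK ?gt_eqF//.
rewrite /lam mulrC divfK ?gt_eqF//.
have := ler_normD v s; lra.
Qed.

(** Noise [v] on one side is matched with [v + s] on the other. Translating the integral of [f']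
    turns this into a comparison of the densities at [v] and at [v + s]. *)
Lemma laplace_step (s K t : R) (f f' : R -> \bar R) : `|s| <= Delta -> 0 <= K ->
  (forall v, 0 <= f v)%E -> (forall v, 0 <= f' v)%E ->
  (forall v t,
     f v <= (expR t)%:E * f' (v + s)%R + (K * expR (- (kap * t)))%:E)%E ->
  (\int[lebesgue_measure]_v ((laplace_pdf lam v)%:E * f v) <=
   (expR t)%:E * \int[lebesgue_measure]_v ((laplace_pdf lam v)%:E * f' v)
     + (K * M * expR (- (kap * t)))%:E)%E.
Proof.
move=> sD K0 f0 f'0 ff'.
have [al [be [albe chord]]] := expR_chord eps_gt0 kap_ge0.
pose p v := laplace_pdf lam v; pose q v := p (v + s).
have p0 v : 0 < p v by exact: laplace_pdf_gt0.
have pq v : p v <= expR eps * q v by exact: laplace_pdf_shift_le.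
have qp v : q v <= expR eps * p v.
  by rewrite -{2}(addrK s v); apply: laplace_pdf_shift_le; rewrite normrN.
pose C := K * expR (- (kap * t)).
have C0 : 0 <= C by rewrite mulr_ge0 ?expR_ge0.
have step v := mechanism_step t K0 (p0 v) (pq v) (qp v) chord (f'0 _) (ff' v).
have mp : measurable_fun setT p by exact: measurable_laplace_pdf.
have mq : measurable_fun setT q.
  by apply: measurableT_comp mp _; exact: measurable_funD.
have ip : (\int[lebesgue_measure]_v (p v)%:E = 1)%E.
  exact: integral_laplace_pdf.
have iq : (\int[lebesgue_measure]_v (q v)%:E = 1)%E.
  rewrite -ip; apply: (ge0_integral_shift s (f := EFin \o p)).
    exact/measurable_EFinP.
  by move=> v; rewrite lee_fin ltW.
have Ip : lebesgue_measure.-integrable setT (EFin \o p).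
  apply/integrableP; split; first exact/measurable_EFinP.
  under eq_integral do rewrite /= ger0_norm ?ltW//.
  by rewrite ip ltry.
have Iq : lebesgue_measure.-integrable setT (EFin \o q).
  apply/integrableP; split; first exact/measurable_EFinP.
  under eq_integral do rewrite /= ger0_norm ?(ltW (p0 _))//.
  by rewrite iq ltry.
(* Both densities have mass 1, so the error term integrates to the value of the chord at 1. *)
have ig : (\int[lebesgue_measure]_v (C * (al * p v + be * q v))%:E
    = (C * (al + be))%:E)%E.
  transitivity (\int[lebesgue_measure]_v
      ((C * al)%:E * (EFin \o p) v + (C * be)%:E * (EFin \o q) v))%E.
    by apply: eq_integral => v _; rewrite /= -!EFinM -EFinD; congr EFin; ring.
  rewrite integralD//; last 2 first.
  - exact: integrableZl.
  - exact: integrableZl.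
  rewrite !integralZl//= ip iq !mule1 -EFinD; congr EFin; ring.
apply: (@le_trans _ _ ((expR t)%:E *
    \int[lebesgue_measure]_v ((q v)%:E * f' (v + s)%R) + (C * (al + be))%:E)%E).
  rewrite -ig; apply: lower_integral_le_comb.
  - exact: expR_gt0.
  - by move=> v; rewrite mule_ge0// lee_fin (ltW (p0 _)).
  - by move=> v; rewrite mule_ge0// lee_fin (ltW (p0 _)).
  - by move=> v; rewrite mulr_ge0//; case: (step v).
  - apply: measurable_funM => //; apply: measurable_funD; exact: measurable_funM.
  - by move=> v; case: (step v).
rewrite leeD//.
  rewrite lee_pmul2l ?fin_numE ?lte_fin ?expR_gt0//.
  apply: (@lower_integral_shift_le _ s (fun v => (p v)%:E * f' v)%E) => v.
  by rewrite mule_ge0// lee_fin ltW.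
by rewrite lee_fin /C [leRHS]mulrAC ler_wpM2l.
Qed.

Lemma laplace_expect_ge0 (n : nat) (f : n.-tuple R -> \bar R) :
  (forall w, 0 <= f w)%E -> (0 <= laplace_expect lam f)%E.
Proof.
elim: n f => [|n IH] f f0 /=; first exact: f0.
apply: integral_ge0 => v _; apply: mule_ge0.
  by rewrite lee_fin ltW// laplace_pdf_gt0.
by apply: IH => w; exact: f0.
Qed.

Lemma laplace_expect_le (n : nat) (s : 'I_n -> R) (K t : R)
    (f f' : n.-tuple R -> \bar R) : (forall i, `|s i| <= Delta) -> 0 <= K ->
  (forall w, 0 <= f w)%E -> (forall w, 0 <= f' w)%E ->
  (forall w t, f w <= (expR t)%:E * f' [tuple (tnth w i + s i)%R | i < n]
     + (K * expR (- (kap * t)))%:E)%E ->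
  (laplace_expect lam f <= (expR t)%:E * laplace_expect lam f'
     + (K * M ^+ n * expR (- (kap * t)))%:E)%E.
Proof.
move=> + K0; elim: n s t f f' => [|n IH] s t f f' sD f0 f'0 ff' /=.
  rewrite expr0 mulr1; have := ff' [tuple] t.
  by congr (_ <= _ * f' _ + _)%E; exact: tuple0.
rewrite exprSr mulrA.
apply: (laplace_step (s := s ord0)) => //.
- by rewrite mulr_ge0// exprn_ge0// expR_ge0.
- by move=> v; apply: laplace_expect_ge0 => w; exact: f0.
- by move=> v; apply: laplace_expect_ge0 => w; exact: f'0.
move=> v {}t; apply: (IH (fun i => s (lift ord0 i))) => // w {}t.
have := ff' [tuple of v :: w] t; congr (_ <= _ * f' _ + _)%E.
apply: eq_from_tnth => i; rewrite tnth_mktuple.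
case: (unliftP ord0 i) => [j|] ->; rewrite ?tnth0//.
by rewrite !tnthS tnth_mktuple.
Qed.

End laplace_step.
End composition.

(** * The rounds of the algorithm *)

(** Keeps the iterates where the oracle is known to be private. A zero normalizer would force all
    coordinates of [x] to vanish, against their sum being 1. *)
Lemma mw_update_simplex (R : realType) (d : nat) (eta : R) (x : d.-tuple R)
    (l : 'I_d -> R) : in_simplex x -> in_simplex (mw_update eta x l).
Proof.
move=> [x0 x1]; pose w i := expR (- eta * l i) * tnth x i.
have w0 i : 0 <= w i by rewrite mulr_ge0 ?expR_ge0.
have W0 : 0 <= \sum_j w j by exact: sumr_ge0.
split=> [i|]; first by rewrite tnth_mktuple; exact: (divr_ge0 (w0 i) W0).
rewrite (eq_bigr (fun i => w i / \sum_j w j)); last first.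
  by move=> i _; rewrite tnth_mktuple.
rewrite -mulr_suml divff//; apply/eqP => /psumr_eq0P wz.
have : \sum_(i < d) tnth x i = 0.
  apply: big1 => i _; have /eqP := wz (fun i _ => w0 i) i isT.
  by rewrite mulf_eq0 gt_eqF ?expR_gt0//= => /eqP.
by rewrite x1 => /eqP; rewrite oner_eq0.
Qed.

Lemma entrywise_close_sym (R : realType) (m d : nat) (Delta : R)
    (A A' : 'M[R]_(m, d)) :
  entrywise_close Delta A A' -> entrywise_close Delta A' A.
Proof. by move=> AA' i j; rewrite distrC; exact: AA'. Qed.

Lemma oracle_private1 (R : realType) (m d : nat) (Orc : oracle R m d)
    (eps Delta : R) (A A' : 'M[R]_(m, d)) b x i :
  oracle_private Orc eps Delta -> in_box A -> in_box A' ->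
  entrywise_close Delta A A' -> in_simplex x ->
  Orc A b x i <= expR eps * Orc A' b x i.
Proof.
move=> priv boxA boxA' AA' xs.
by have := priv _ _ b _ boxA boxA' AA' xs [set i]%SET; rewrite !big_set1.
Qed.

Section rounds.
Variables (R : realType) (m d : nat) (Orc : oracle R m d).
Variables (alpha eps Delta kap : R) (b : m.-tuple R).
Hypotheses (kap_ge0 : 0 <= kap) (eps_gt0 : 0 < eps) (Delta_gt0 : 0 < Delta).

Lemma lp_rounds_ge0 A n s x S :
  (0 <= lp_rounds Orc alpha (Delta / eps) b A n s x S)%E.
Proof.
elim: n s x => [|n IH] s x /=; first by rewrite measure_ge0.
apply: sume_ge0 => p _; rewrite mule_ge0 ?lee_fin ?pick_ge0//.
by apply: laplace_expect_ge0 => // w; exact: IH.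
Qed.

Lemma lp_rounds_le (A A' : 'M[R]_(m, d)) n s x S t :
  oracle_private Orc eps Delta -> in_box A -> in_box A' ->
  entrywise_close Delta A A' -> in_simplex x ->
  (lp_rounds Orc alpha (Delta / eps) b A n s x S <=
   (expR t)%:E * lp_rounds Orc alpha (Delta / eps) b A' n s x S
   + (expR (kap * (kap + 1) * eps ^+ 2 / 2) ^+ (n * d.+1)
      * expR (- (kap * t)))%:E)%E.
Proof.
move=> priv boxA boxA' AA'; elim: n s x t => [|n IH] s x t xs.
  rewrite mul0n expr0 mul1r /= diracE; case: (_ \in _); last first.
    by rewrite mule0 add0e lee_fin expR_ge0.
  (* It remains to see that 1 <= e^t + e^(- kap t): the first term suffices for t >= 0, the second
     for t <= 0. *)
  rewrite mule1 -EFinD lee_fin; have [t0|/ltW t0] := leP 0 t.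
    by rewrite ler_wpDr ?expR_ge0// -expR0 ler_expR.
  by rewrite ler_wpDl ?expR_ge0// -expR0 ler_expR oppr_ge0 mulr_ge0_le0.
set M := expR (_ / 2).
(* The exponent splits into [n * d.+1] for the later rounds, [d] for the Laplace draws and 1 for the
   oracle call. *)
rewrite mulSnr /= addnS exprSr exprD.
apply: finite_step => //.
- by rewrite mulr_ge0 ?exprn_ge0 ?expR_ge0.
- by move=> i; exact: pick_ge0.
- by move=> i; exact: pick_ge0.
- exact: pick_sum1.
- exact: pick_sum1.
- by move=> i; exact: oracle_private1 priv _ _ _ _.
- move=> i; apply: (oracle_private1 _ _ priv) => //.
  exact: entrywise_close_sym.
- by move=> p; apply: laplace_expect_ge0 => // w; exact: lp_rounds_ge0.
- by move=> p; apply: laplace_expect_ge0 => // w; exact: lp_rounds_ge0.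
move=> p {}t.
apply: (laplace_expect_le kap_ge0 eps_gt0 Delta_gt0
  (s := fun i => A p i - A' p i)).
- by move=> i; exact: AA'.
- by rewrite exprn_ge0// expR_ge0.
- by move=> w; exact: lp_rounds_ge0.
- by move=> w; exact: lp_rounds_ge0.
move=> w {}t.
(* The shift by [A p i - A' p i] makes the two noisy losses equal, so both runs continue from the
   same iterate. *)
have -> : mw_update (learning_rate d alpha) x
    (noisy_loss A' p [tuple (tnth w i + (A p i - A' p i))%R | i < d])
  = mw_update (learning_rate d alpha) x (noisy_loss A p w).
  congr mw_update; apply/funext => i; rewrite /noisy_loss tnth_mktuple; ring.
by apply: IH; exact: mw_update_simplex.
Qed.

End rounds.

(** * Choice of the parameters *)

Theorem theorem25 (R : realType) (m d : nat)
    (eps delta Delta alpha alphaO gamma : R) (Orc : oracle R m d)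
    (eps_gt0 : 0 < eps) (delta_gt0 : 0 < delta) (Delta_gt0 : 0 < Delta)
    (alpha_gt0 : 0 < alpha)
    (eps_le : eps <= 8 * ln (1 / delta)) :
  let T := num_iter d alpha in
  let eps' := eps / (4 * Num.sqrt (d%:R * T%:R * ln (1 / delta))) in
  dual_oracle alphaO gamma Orc ->
  oracle_private Orc eps' Delta ->
  low_sensitivity_row_private (row_private_lp Orc alpha (Delta / eps'))
    eps delta Delta.
Proof.
move=> T eps' _ priv b A A' boxA boxA' AA' S mS.
rewrite /row_private_lp -/T.
(* With no rounds the output is a fixed point, the same for [A] and [A']. *)
have [T0|T0] := posnP T.
  rewrite T0 /= diracE; case: (_ \in _); last by rewrite mule0 add0e lee_fin ltW.
  rewrite mule1 -EFinD lee_fin ler_wpDr//; first exact: ltW.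
  by rewrite -expR0 ler_expR ltW.
(* For [d <= 1] the logarithm is 0 (by convention when [d = 0]), and then [T = 0]. *)
have d2 : (1 < d)%N.
  rewrite ltnNge; apply/negP => d1; move: T0; rewrite /T /num_iter.
  rewrite (_ : ln _ = 0) ?mulr0 ?mul0r ?ceil0//.
  by move: d1; case: (d) => [|[|//]] _; rewrite ?ln1// ln0.
set L := ln (1 / delta) in eps_le eps' priv *.
have L0 : 0 < L by lra.
have N0 : 0 < d%:R * T%:R * L :> R by rewrite !mulr_gt0 ?ltr0n// (ltn_trans _ d2).
have eps'0 : 0 < eps' by rewrite divr_gt0// mulr_gt0// sqrtr_gt0.
(* With kap = c L / eps the final inequality becomes eps <= (16 - 16 / c - c) L; c = 4 maximizes the
   right side and gives [eps_le]. *)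
pose kap := 4 * L / eps.
have kap0 : 0 < kap by rewrite divr_gt0// mulr_gt0.
have xs : in_simplex [tuple (d%:R : R)^-1 | i < d].
  split=> [i|]; first by rewrite tnth_mktuple invr_ge0.
  under eq_bigr do rewrite tnth_mktuple.
  rewrite sumr_const card_ord -[RHS](@mulVf _ (d%:R : R)) ?mulr_natr//.
  by rewrite pnatr_eq0 -lt0n (ltn_trans _ d2).
have := @lp_rounds_le R m d Orc alpha eps' Delta kap b (ltW kap0) eps'0 Delta_gt0
  A A' T [tuple 0 | i < d] _ S eps priv boxA boxA' AA' xs.
move=> /le_trans; apply; rewrite leeD2l// lee_fin.
have -> : delta = expR (- L) by rewrite /L div1r lnV ?posrE// opprK lnK.
rewrite -expRM_natl -expRD ler_expR.
have e2 : eps' ^+ 2 = eps ^+ 2 / (16 * (d%:R * T%:R * L)).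
  rewrite /eps' expr_div_n exprMn sqr_sqrtr ?(ltW N0)//; congr (_ / (_ * _)); ring.
have kL : kap * eps = 4 * L by rewrite /kap divfK// gt_eqF.
have Td : (T * d.+1)%:R <= 2 * (d%:R * T%:R) :> R.
  rewrite -!natrM ler_nat mulnC mulnA leq_mul2r mul2n -addnn -addn1 leq_add2l.
  by rewrite (ltnW d2) orbT.
have k1 : kap * (kap + 1) * (eps ^+ 2 / (16 * L)) = L + eps / 4.
  by rewrite /kap; field; rewrite !gt_eqF.
have D0 : 0 < d%:R * T%:R :> R by rewrite -natrM ltr0n muln_gt0 T0 (ltn_trans _ d2).
have : (T * d.+1)%:R * (kap * (kap + 1) * eps' ^+ 2 / 2) <= L + eps / 4.
  rewrite -k1 e2.
  apply: (@le_trans _ _ (2 * (d%:R * T%:R) *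
      (kap * (kap + 1) * (eps ^+ 2 / (16 * (d%:R * T%:R * L))) / 2))).
    rewrite ler_wpM2r// -e2 divr_ge0// mulr_ge0 ?sqr_ge0// mulr_ge0 ?ltW//.
    by rewrite addr_gt0.
  rewrite le_eqVlt; apply/orP; left; apply/eqP; field.
  by rewrite gt_eqF// !pnatr_eq0 -!lt0n T0 (ltn_trans _ d2).
(* The total exponent is at most L + eps / 4 - 4 L, which is at most - L exactly when eps <= 8 L. *)
move=> h; rewrite (mulrC kap) in kL; lra.
Qed.
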